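(* Let $A=\{1,2,3\}$, with $A^{-}=\{1^{\ast},2^{\ast},3^{\ast}\}$. Then $$\left|3^{A}\right|=\left|\left\langle 2^{A},2^{A^{-}}\right\rangle\right|=3^{3}=27.$$
   Context: Background on $\sigma$-sets: in $\sigma$-set theory (a theory of classes) two elements $x,y$ are called antielements of each other when $\{x\}\cup\{y\}=\emptyset$, where $\cup$ here is the primitive pair union of the theory. If $x$ has an antielement it is denoted $x^{\ast}$; the relation is symmetric, so $(x^{\ast})^{\ast}=x$. A basic known fact of the theory is that a $\sigma$-set never contains both an element $x$ and its antielement $x^{\ast}$. $\sigma$-sets are determined by their elements, and $\emptyset$ is the $\sigma$-set with no elements. The natural numbers $1,2,3,\ldots$ and the antinatural numbers $1^{\ast},2^{\ast},3^{\ast},\ldots$ are pairwise distinct objects of the theory, and for each $n$ the antielement of $n$ is $n^{\ast}$ (and the antielement of $n^{\ast}$ is $n$). Definitions, for $\sigma$-sets $A,B$: - $2^{A}$ is the collection of all subsets of $A$. - $\ast$-intersection: $A\widehat{\cap}B=\{x\in A : x^{\ast}\in B\}$. - Difference: $A-B=\{x\in A: x\notin B\}$. - $\ast$-difference: $A\divideontimes B=A-(A\widehat{\cap}B)$. - Fusion: $A\oplus B=\{x : x\in A\divideontimes B\ \vee\ x\in B\divideontimes A\}$. - The $\sigma$-antiset $A^{-}$ of $A$ is the $\sigma$-set with $A\oplus A^{-}=\emptyset$. - Generated space: $\left\langle 2^{A},2^{B}\right\rangle=\{x\oplus y : x\in 2^{A}\wedge y\in 2^{B}\}$. - Integer space: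 $3^{A}=\left\langle 2^{A},2^{A^{-}}\right\rangle$. $|\cdot|$ denotes cardinality. *)

(* Defs.v *)
From HB Require Import structures.
From mathcomp Require Import all_boot.
From mathcomp Require Import boolp classical_sets cardinality.

Set Implicit Arguments.
Unset Strict Implicit.
Unset Printing Implicit Defensive.

Local Open Scope classical_set_scope.

(* Every object of the universe is a sigma-set; classes are the Rocq sets
   [set T].  [punion (sing x) (sing y)] is the primitive pair union
   {x} U {y}, a sigma-set which is not the ordinary union when x and y are
   antielements. *)
Record sigmaStructure := SigmaStructure {
  sigma_sort :> Type;
  mem_sigma : sigma_sort -> sigma_sort -> Prop;
  emp : sigma_sort;
  sing : sigma_sort -> sigma_sort;
  punion : sigma_sort -> sigma_sort -> sigma_sort;
  num : nat -> sigma_sort;      (* n, meaningful for n >= 1 *)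
  antinum : nat -> sigma_sort   (* n^*, meaningful for n >= 1 *)
}.

Arguments emp {s}.
Arguments num {s} n.
Arguments antinum {s} n.

HB.instance Definition _ (T : sigmaStructure) := gen_eqMixin (sigma_sort T).
HB.instance Definition _ (T : sigmaStructure) := gen_choiceMixin (sigma_sort T).

Section Operations.
Variable T : sigmaStructure.
Implicit Types (A B : T) (P Q : set T).

Definition elts A : set T := [set x | mem_sigma x A].

(* The sigma-set whose elements are those of the class P (emp if there is
   none). *)
Definition sigma_of P : T := xget emp [set A | elts A = P].

Definition anti (x y : T) : Prop := punion (sing x) (sing y) = emp.

(* The intermediate operations are taken on classes, so that only fusions need
   be assumed to be sigma-sets. *)
Definition starcap P Q : set T := [set x | P x /\ exists2 y, anti x y & Q y].

Definition stardiff P Q : set T := P `\` starcap P Q.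

Definition fusion_class P Q : set T :=
  [set x | stardiff P Q x \/ stardiff Q P x].

Definition fusion A B : T := sigma_of (fusion_class (elts A) (elts B)).

(* emp if no B satisfies the condition, for instance when some element of A
   has no antielement. *)
Definition antiset A : T := xget emp [set B | fusion A B = emp].

Definition powset A : set T := [set x | elts x `<=` elts A].

Definition gen_space P Q : set T :=
  [set z | exists x y, [/\ P x, Q y & z = fusion x y]].

Definition integer_space A : set T :=
  gen_space (powset A) (powset (antiset A)).

(* The facts of sigma-set theory used here.  By [fusionP] and [ext_sigma], the
   [sigma_of] in [fusion] is a genuine definite description.
   These facts are jointly satisfiable: take nat as universe, with x an element
   of n when the digit of weight 3 ^ x./2 of n in base 3 is (odd x).+1, so that
   2k and 2k+1 are antielements. *)
Record sigma_theory : Prop := SigmaTheory {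
  ext_sigma : forall A B, elts A = elts B -> A = B;
  empP : elts emp = set0;
  singP : forall x : T, elts (sing x) = [set x];
  punionP : forall x y : T,
    ~ anti x y -> elts (punion (sing x) (sing y)) = [set x; y];
  anti_sym : forall x y : T, anti x y -> anti y x;
  anti_uniq : forall x y z : T, anti x y -> anti x z -> y = z;
  no_anti : forall A (x y : T), elts A x -> elts A y -> ~ anti x y;
  fusionP : forall A B,
    exists C, elts C = fusion_class (elts A) (elts B);
  num_inj : forall m n,
    (0 < m)%N -> (0 < n)%N -> num m = num n :> T -> m = n;
  antinum_inj : forall m n,
    (0 < m)%N -> (0 < n)%N -> antinum m = antinum n :> T -> m = n;
  num_antinum : forall m n,
    (0 < m)%N -> (0 < n)%N -> num m <> antinum n :> T;
  anti_num : forall n, (0 < n)%N -> anti (num n : T) (antinum n)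
}.

End Operations.

(* Main.v *)
(* A sigma-set never contains two antielements, so fusing subsets of A and A^-
   produces exactly the sigma-sets C with elements in A or A^-.  Such a C is
   encoded by the map sending each x of A to Some true, Some false or None
   according to whether C contains x, x^* or neither: there are three
   independent choices for each element of A. *)
Require Import Defs.
From mathcomp Require Import all_boot.
From mathcomp Require Import boolp classical_sets cardinality.

Set Implicit Arguments.
Unset Strict Implicit.
Unset Printing Implicit Defensive.

Local Open Scope classical_set_scope.
Local Open Scope card_scope.

Lemma card_finType (I : finType) : [set: I] #= `I_#|I|.
Proof.
apply/card_set_bijP; exists (fun i => val (enum_rank i)); split.
- by move=> i _ /=; exact: ltn_ord.
- by move=> i j _ _ /val_inj /enum_rank_inj.
- by move=> n /= lt_n; exists (enum_val (Ordinal lt_n)); rewrite ?enum_valK.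
Qed.

Section SigmaTheory.
Variables (T : sigmaStructure) (hT : sigma_theory T).
Implicit Types (A B C : T) (P Q : set T).

Definition antifree P := forall x y, P x -> P y -> ~ anti x y.

Lemma sigma_ofP P : (exists C, elts C = P) -> elts (sigma_of P) = P.
Proof. by case=> C PC; exact: (@xgetPex _ emp [set A | elts A = P] (ex_intro _ C PC)). Qed.

Lemma elts_fusion A B : elts (fusion A B) = fusion_class (elts A) (elts B).
Proof. by apply: sigma_ofP; exact: fusionP. Qed.

(** No element finds an antielement on the other side, so both [starcap]s are empty and nothing
    cancels. *)
Lemma fusion_class_antifree P Q :
  antifree (P `|` Q) -> fusion_class P Q = P `|` Q.
Proof.
move=> PQ; apply/seteqP; split=> x; first by move=> [[]|[]]; [left|right].
by case=> hx; [left|right]; split=> // -[_ [y xy hy]]; apply: PQ xy;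
  by [left|right].
Qed.

(** The substitute for comprehension: the class is built from [emp] by fusing in one singleton at a
    time, and antifreeness rules out any cancellation on the way. *)
Lemma finite_sigma_set P :
  finite_set P -> antifree P -> exists C, elts C = P.
Proof.
move=> /finite_seqP[s ->]; elim: s => [|x s IH] free.
  by exists emp; rewrite (empP hT); apply/seteqP; split.
have [y z ys zs|C eC] := IH; first by apply: free; rewrite /= inE ?ys ?zs orbT.
have e : [set` x :: s] = [set x] `|` elts C.
  rewrite eC; apply/seteqP; split=> y /=; rewrite inE.
    by case/orP=> [/eqP|]; [left|right].
  by case=> [->|->]; rewrite ?eqxx ?orbT.
exists (fusion (sing x) C); rewrite elts_fusion (singP hT).
by rewrite fusion_class_antifree -e.
Qed.

Section Family.
Variables (I : finType) (a b : I -> T) (A : T).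
Hypotheses (a_inj : injective a) (anti_ab : forall i, anti (a i) (b i)).
Hypothesis (hA : elts A = range a).

Let elts_a i : elts A (a i). Proof. by rewrite hA; exists i. Qed.

Let anti_aE i x : anti (a i) x -> x = b i.
Proof. by move=> ax; exact: (anti_uniq hT ax). Qed.

Let anti_bE i x : anti (b i) x -> x = a i.
Proof. by move=> bx; exact: (anti_uniq hT bx (anti_sym hT (anti_ab i))). Qed.

(** Otherwise [A] would contain both [a j] and its antielement. *)
Let a_neq_b i j : a i <> b j.
Proof.
by move=> e; apply: (no_anti hT (elts_a j) (elts_a i)); rewrite e.
Qed.

Let b_inj : injective b.
Proof.
move=> i j e; apply: a_inj; apply: anti_bE.
by rewrite -e; apply: anti_sym.
Qed.

Lemma elts_antiset : elts (antiset A) = range b.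
Proof.
have fusion0 B : fusion A B = emp <-> elts B = range b.
  split=> [e|eB].
    have {}e : fusion_class (elts A) (elts B) = set0.
      by rewrite -elts_fusion e (empP hT).
    (* An [x] in [B] outside [range b] has no antielement in [A], and an [a i] with [b i] missing
       from [B] has none in [B]; either one would survive in the fusion. *)
    apply/seteqP; split=> [x Bx|_ [i _ <-]]; apply: contrapT => hx.
      suff : fusion_class (elts A) (elts B) x by rewrite e.
      right; split=> // -[_ [y xy]]; rewrite hA => -[i _ ai].
      by apply: hx; exists i => //; rewrite (@anti_aE i x)// ai; apply: anti_sym.
    suff : fusion_class (elts A) (elts B) (a i) by rewrite e.
    by left; split=> // -[_ [y /anti_aE ->]].
  apply: (ext_sigma hT); rewrite elts_fusion (empP hT) hA eB.
  apply/seteqP; split=> // x [] [[i _ <-]]; apply; split; try by exists i.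
    by exists (b i) => //; exists i.
  by exists (a i); [apply: anti_sym|exists i].
(* [antiset] defaults to [emp], so a solution must be exhibited. The class [range b] is finite, and
   antifree because the only antielement of [b i] is [a i], which is no [b j]. *)
apply/fusion0; apply: (@xgetPex _ emp [set B | fusion A B = emp]).
have [||B eB] := @finite_sigma_set (range b).
- exact: finite_image.
- by move=> _ _ [i _ <-] [j _ <-] /anti_bE /esym /a_neq_b.
- by exists B; apply/fusion0.
Qed.

(** A fusion only discards elements, which gives one inclusion. Conversely, [C] is the fusion of its
    traces on [range a] and [range b]: their union is [C], which contains no antielements, so
    nothing cancels. *)
Lemma integer_spaceE :
  integer_space A = [set C | elts C `<=` range a `|` range b].
Proof.
rewrite /integer_space /gen_space /powset elts_antiset hA.
apply/seteqP; split=> [_ [x [y [xa yb ->]]]|C /= Cab].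
  rewrite /= elts_fusion => z [[] /xa|[] /yb]; first by left.
  by right.
have part P : finite_set P -> exists D, elts D = elts C `&` P.
  move=> finP; apply: finite_sigma_set; first exact: finite_setIr.
  by move=> x y [Cx _] [Cy _]; exact: (no_anti hT Cx Cy).
have [x ex] := part (range a) (finite_image _ (@finite_finset _ _)).
have [y ey] := part (range b) (finite_image _ (@finite_finset _ _)).
have eC : elts C = elts x `|` elts y.
  by rewrite ex ey -setIUr; apply/esym/setIidPl.
exists x, y; split; rewrite ?ex ?ey; try exact: subIsetr.
apply: (ext_sigma hT); rewrite elts_fusion fusion_class_antifree -?eC//.
by move=> u v; exact: (no_anti hT).
Qed.

Definition signed_class (f : {ffun I -> option bool}) : set T :=
  [set x | exists i, (f i = Some true /\ x = a i) \/
                     (f i = Some false /\ x = b i)].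

Lemma signed_class_sub f : signed_class f `<=` range a `|` range b.
Proof. by move=> x [i [] [_ ->]]; [left|right]; exists i. Qed.

Lemma signed_class_a f i : signed_class f (a i) <-> f i = Some true.
Proof.
split=> [[j [] [fj]]|fi]; last by exists i; left.
  by move=> /a_inj ->.
by move=> /a_neq_b.
Qed.

Lemma signed_class_b f i : signed_class f (b i) <-> f i = Some false.
Proof.
split=> [[j [] [fj]]|fi]; last by exists i; right.
  by move=> /esym /a_neq_b.
by move=> /b_inj ->.
Qed.

(** The default [emp] of [sigma_of] is not reached: [f i] has a single value, so the class never
    contains both [a i] and [b i], and it is finite. *)
Lemma elts_signed f : elts (sigma_of (signed_class f)) = signed_class f.
Proof.
apply/sigma_ofP/finite_sigma_set.
  apply: (sub_finite_set (@signed_class_sub f)).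
  by rewrite finite_setU; split; exact: finite_image.
move=> x y /[swap] fy [i [] [fi ->]].
  by move=> /anti_aE ey; move: fy; rewrite ey signed_class_b fi.
by move=> /anti_bE ey; move: fy; rewrite ey signed_class_a fi.
Qed.

Lemma integer_space_signed :
  integer_space A = range (fun f => sigma_of (signed_class f)).
Proof.
rewrite integer_spaceE; apply/seteqP; split=> [C /= Cab|_ [f _ <-]]; last first.
  by rewrite /= elts_signed; exact: signed_class_sub.
pose f := [ffun i => if `[< elts C (a i) >] then Some true
                     else if `[< elts C (b i) >] then Some false else None].
exists f => //; apply: (ext_sigma hT); rewrite elts_signed.
apply/seteqP; split=> [x [i]|x Cx].
  rewrite /f ffunE; case: asboolP => Ca; first by case=> -[] // _ ->.
  by case: asboolP => Cb; case=> -[] // _ ->.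
case: (Cab _ Cx) => -[i _ ei]; rewrite -ei in Cx *.
  by apply/signed_class_a; rewrite ffunE asboolT.
(* Testing [a i] first in [f] loses nothing: by [no_anti], [C] cannot contain both [a i] and
   [b i]. *)
apply/signed_class_b; rewrite ffunE asboolF ?asboolT// => Ca.
exact: (no_anti hT Ca Cx).
Qed.

(** The value [f i] can be read off from whether [a i] and [b i] are elements. *)
Lemma signed_inj : injective (fun f => sigma_of (signed_class f)).
Proof.
move=> f g /(congr1 (@elts T)); rewrite !elts_signed => fg.
apply/ffunP=> i; have := signed_class_a f i; have := signed_class_b f i.
rewrite fg signed_class_a signed_class_b.
case: (f i) (g i) => [[]|] [[]|] //.
all: by move=> [h1 h2] [h3 h4]; by [have := h1 erefl|have := h2 erefl|
  have := h3 erefl|have := h4 erefl].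
Qed.

Lemma card_integer_space : integer_space A #= `I_(3 ^ #|I|).
Proof.
rewrite integer_space_signed (card_eql (inj_card_eq (in2W signed_inj))).
have -> : (3 ^ #|I|)%N = #|{: {ffun I -> option bool}}|.
  by rewrite card_ffun card_option card_bool.
exact: card_finType.
Qed.

End Family.
End SigmaTheory.

Lemma range_ord3 (U : Type) (f : nat -> U) :
  range (fun i : 'I_3 => f i.+1) = [set f 1; f 2; f 3].
Proof.
apply/seteqP; split=> [_ [[[|[|[|//]]] lti] _ <-]|_ [[|]|] ->] /=.
- by left; left.
- by left; right.
- by right.
- by exists (@Ordinal 3 0 isT).
- by exists (@Ordinal 3 1 isT).
- by exists (@Ordinal 3 2 isT).
Qed.

Theorem theorem2p2 (T : sigmaStructure) (hT : sigma_theory T) (A : T)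
    (hA : elts A = [set num 1; num 2; num 3]) :
  elts (antiset A) = [set antinum 1; antinum 2; antinum 3] /\
  [/\ integer_space A #= gen_space (powset A) (powset (antiset A)),
      gen_space (powset A) (powset (antiset A)) #= `I_(3 ^ 3)
    & (3 ^ 3)%N = 27%N].
Proof.
(* Ordinals start at 0; the shift to [i.+1] gives the indices 1, 2, 3 and the positivity that
   [anti_num] and [num_inj] require. *)
have anti_n (i : 'I_3) : anti (num i.+1 : T) (antinum i.+1).
  exact: anti_num.
have inj : injective (fun i : 'I_3 => num i.+1 : T).
  by move=> i j /(num_inj hT) e; apply/val_inj/succn_inj/e.
rewrite -(range_ord3 num) in hA.
split; first by rewrite (elts_antiset hT anti_n hA) (range_ord3 antinum).
split=> //.
by have := card_integer_space hT inj anti_n hA; rewrite card_ord.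
Qed.
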